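(* Let $z\in\mathbb{C}$ and let $(a_n)_{n\in\mathbb{N}_0}$, $(b_n)_{n\in\mathbb{N}_0}$ be the positive sequences $a_n=\lambda_n\Delta(x)^r$, $b_n=\mu_n\Delta(x)^s$ for a fixed $x\in\mathbb{R}^2$. Set $p_{-1}=q_{-1}=0$. Then one can choose, successively for $n=-1,0,1,2,\dots$, minimizers $$(p_{n+1}^*,q_{n+1}^* )\in\operatorname*{arg\,min}_{p,q\in\mathbb{C}}\ |(p+p_n)(q+q_n)-z|^2+a_{n+1}|p|^2+b_{n+1}|q|^2,$$ with $p_{n+1}:=p_n+p_{n+1}^*$ and $q_{n+1}:=q_n+q_{n+1}^*$, in such a way that for all $n\in\mathbb{N}_0$: (i) $q_n\in[0,\infty)$; (ii) $\bar z p_n=z\bar p_n\in[0,\infty)$; (iii) $\bar z p_nq_n\le|z|^2$.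
   Context: $\Delta(x)=1+|x|^2$ for $x\in\mathbb{R}^2$; $r,s\ge0$; $(\lambda_n)_{n\in\mathbb{N}_0}$ and $(\mu_n)_{n\in\mathbb{N}_0}$ are decreasing sequences of positive real numbers. (In the application, $z=\hat f(x)$ is the value at $x$ of the Fourier transform of the observed image, and $p_n,q_n$ are the values at $x$ of the Fourier transforms of the $n$-th image and kernel iterates.) The bar denotes complex conjugation. *)

(* Defs.v *)
From mathcomp Require Import all_boot all_order all_algebra.
From mathcomp Require Import all_classical all_reals all_analysis.
From mathcomp Require Export complex.

Set Implicit Arguments.
Unset Strict Implicit.
Unset Printing Implicit Defensive.

Import Order.TTheory GRing.Theory Num.Theory.

Local Open Scope classical_set_scope.
Local Open Scope ring_scope.
Local Open Scope complex_scope.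

(* |x| is the Euclidean norm; the library norm on 'rV[R]_2 is the sup norm. *)
Definition Delta (R : realType) (x : 'rV[R]_2) : R :=
  1 + \sum_(i < 2) x 0 i ^+ 2.

(* The value is real; it is kept in R[i] because `|_| on R[i] is R[i]-valued,
   and the order of R[i] restricts to the usual one on the reals. *)
Definition objective (R : realType) (z : R[i]) (a b : R) (p0 q0 : R[i])
    (pq : R[i] * R[i]) : R[i] :=
  `|(pq.1 + p0) * (pq.2 + q0) - z| ^+ 2
  + a%:C * `|pq.1| ^+ 2 + b%:C * `|pq.2| ^+ 2.

Definition argmin (d : Order.disp_t) (T : Type) (V : porderType d)
    (J : T -> V) : set T :=
  [set t | forall t', (J t <= J t')%O].

(* The term of index n - 1 of u, with the convention u_{-1} = 0. *)
Definition prev_term (V : zmodType) (u : nat -> V) (n : nat) : V :=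
  if n is m.+1 then u m else 0.

(* Main.v *)
(** Write [z = m w] with [m = |z|] and [|w| = 1].  If [p_n = w P] and [q_n = Q]
    with [P, Q >= 0], then replacing the new iterates [u, v] by [w |u|] and [|v|]
    does not increase the objective, by the reverse triangle inequality.  So it
    suffices to minimize
    [F(U, V) = (U V - m)^2 + a (U - P)^2 + b (V - Q)^2] over [U, V >= 0], where a
    minimizer exists by coercivity.  At a minimizer both partial derivatives
    vanish: [V (U V - m) = a (P - U)] and [U (U V - m) = b (Q - V)].  Hence
    [U V > m] would force [U <= P] and [V <= Q], so [U V <= P Q <= m]: the bound
    [P Q <= m] is inherited by the next iterate. *)
Require Import Defs.
From mathcomp Require Import all_boot all_order all_algebra.
From mathcomp Require Import all_classical all_reals all_analysis.
From mathcomp Require Import ring lra.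

Set Implicit Arguments.
Unset Strict Implicit.
Unset Printing Implicit Defensive.

Import Order.TTheory GRing.Theory Num.Theory.
Import numFieldNormedType.Exports.
Local Open Scope classical_set_scope.
Local Open Scope ring_scope.
Local Open Scope complex_scope.

Definition polar_objective (R : realType) (m a b P Q U V : R) : R :=
  (U * V - m) ^+ 2 + a * (U - P) ^+ 2 + b * (V - Q) ^+ 2.

Lemma polar_objectiveC (R : realType) (m a b P Q U V : R) :
  polar_objective m a b P Q U V = polar_objective m b a Q P V U.
Proof. by rewrite /polar_objective; ring. Qed.

Lemma polar_objective_continuous (R : realType) (m a b P Q : R) :
  continuous (fun t : R * R => polar_objective m a b P Q t.1 t.2).
Proof.
move=> t; rewrite /polar_objective.
have c1 : (fun t : R * R => t.1) @ t --> t.1 by exact: cvg_fst.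
have c2 : (fun t : R * R => t.2) @ t --> t.2 by exact: cvg_snd.
have sqr (f : R * R -> R) (l k : R) :
    f @ t --> l -> (fun u => (f u - k) ^+ 2) @ t --> (l - k) ^+ 2.
  move=> fl; have fk : (fun u => f u - k) @ t --> l - k.
    by apply: cvgB => //; exact: cvg_cst.
  by rewrite expr2; exact: (cvgM fk fk).
apply: cvgD; first apply: cvgD.
- by apply: sqr; exact: cvgM.
- by apply: cvgM; [exact: cvg_cst | exact: sqr].
- by apply: cvgM; [exact: cvg_cst | exact: sqr].
Qed.

(** At [(P, Q)] only the first square survives. The summand [1] makes [U - P] at least 1, so
    squaring does not shrink it and the [a]-term alone exceeds that value, whatever [V] is. *)
Lemma polar_objective_coercive (R : realType) (m a b P Q U V : R) :
  0 < a -> 0 <= b -> P + ((P * Q - m) ^+ 2 / a + 1) <= U ->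
  polar_objective m a b P Q P Q <= polar_objective m a b P Q U V.
Proof.
move=> a0 b0 leU; rewrite /polar_objective !subrr expr0n /= !mulr0 !addr0.
set F0 := (P * Q - m) ^+ 2 in leU *.
have F0_ge0 : 0 <= F0 by exact: sqr_ge0.
have F0a : 0 <= F0 / a by rewrite divr_ge0 // ltW.
have dU : 1 <= U - P by lra.
have : F0 / a <= (U - P) ^+ 2 by nra.
rewrite ler_pdivrMr // mulrC => h.
have h1 := sqr_ge0 (U * V - m).
have h2 : 0 <= b * (V - Q) ^+ 2 by rewrite mulr_ge0 ?sqr_ge0.
lra.
Qed.

Lemma polar_objective_min (R : realType) (m a b P Q : R) :
  0 < a -> 0 < b -> 0 <= P -> 0 <= Q ->
  exists2 t : R * R, 0 <= t.1 /\ 0 <= t.2 &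
    forall U V, 0 <= U -> 0 <= V ->
      polar_objective m a b P Q t.1 t.2 <= polar_objective m a b P Q U V.
Proof.
move=> a0 b0 P0 Q0.
(* [c] and [d] are the coercivity thresholds in each variable. Outside the box [A] the point
   [(P, Q)], which lies in [A], is at least as good, so a minimizer on [A] is one on the whole
   quadrant. *)
pose c := P + ((P * Q - m) ^+ 2 / a + 1).
pose d := Q + ((Q * P - m) ^+ 2 / b + 1).
have Pc : P <= c by rewrite lerDl addr_ge0 // divr_ge0 ?sqr_ge0 ?ltW.
have Qd : Q <= d by rewrite lerDl addr_ge0 // divr_ge0 ?sqr_ge0 ?ltW.
pose A := `[0, c] `*` `[0, d] : set (R * R).
have AP : A (P, Q) by split; rewrite /= in_itv /=; apply/andP.
have cptA : compact A by apply: compact_setX; exact: segment_compact.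
have [||[U0 V0] /set_mem [/= U0in V0in] minA] := @compact_EVT_min _ _
    (fun t : R * R => polar_objective m a b P Q t.1 t.2) A _ cptA.
- by exists (P, Q).
- by apply: continuous_subspaceT; exact: polar_objective_continuous.
move: U0in V0in; rewrite !in_itv /= => /andP[U00 _] /andP[V00 _].
exists (U0, V0) => //= U V U_ge0 V_ge0.
have minPQ := minA (P, Q) (mem_set AP); rewrite /= in minA minPQ.
have [Uc|/ltW cU] := leP U c; last first.
  by apply: le_trans minPQ _; apply: polar_objective_coercive => //; exact: ltW.
have [Vd|/ltW dV] := leP V d; last first.
  apply: le_trans minPQ _; rewrite !(polar_objectiveC m a).
  by apply: polar_objective_coercive => //; exact: ltW.
by apply: (minA (U, V)); apply: mem_set; split; rewrite /= in_itv /=; apply/andP.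
Qed.

(* For fixed [V] the objective is a quadratic in [U] whose vertex is nonnegative. *)
Lemma polar_objective_critical (R : realType) (m a b P Q U V : R) :
  0 <= m -> 0 < a -> 0 <= P -> 0 <= V ->
  (forall U', 0 <= U' ->
     polar_objective m a b P Q U V <= polar_objective m a b P Q U' V) ->
  V * (U * V - m) = a * (P - U).
Proof.
move=> m0 a0 P0 V0 minU.
have D0 : 0 < V ^+ 2 + a by rewrite ltr_wpDl ?sqr_ge0.
pose U1 := (m * V + a * P) / (V ^+ 2 + a).
have U1_ge0 : 0 <= U1.
  by rewrite divr_ge0 ?(ltW D0) // addr_ge0 ?mulr_ge0 // ltW.
have U1E : U1 * (V ^+ 2 + a) = m * V + a * P by rewrite divfK ?gt_eqF.
have gapE : polar_objective m a b P Q U V - polar_objective m a b P Q U1 V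
    = (V ^+ 2 + a) * (U - U1) ^+ 2.
  (* A polynomial identity for any [U1]; the last summand vanishes by the vertex equation [U1E]. *)
  have -> : polar_objective m a b P Q U V - polar_objective m a b P Q U1 V
      = (V ^+ 2 + a) * (U - U1) ^+ 2
        + 2 * (U - U1) * (U1 * (V ^+ 2 + a) - (m * V + a * P)).
    by rewrite /polar_objective; ring.
  by rewrite U1E subrr mulr0 addr0.
have : (V ^+ 2 + a) * (U - U1) ^+ 2 <= 0 by rewrite -gapE subr_le0 minU.
rewrite pmulr_rle0 // => dU.
have /eqP : (U - U1) ^+ 2 == 0 by rewrite eq_le dU sqr_ge0.
move=> /eqP; rewrite sqrf_eq0 subr_eq0 => /eqP UE.
rewrite -UE in U1E; lra.
Qed.

Lemma polar_step (R : realType) (m a b P Q : R) :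
  0 <= m -> 0 < a -> 0 < b -> 0 <= P -> 0 <= Q -> P * Q <= m ->
  exists t : R * R, [/\ 0 <= t.1, 0 <= t.2, t.1 * t.2 <= m &
    forall U V, 0 <= U -> 0 <= V ->
      polar_objective m a b P Q t.1 t.2 <= polar_objective m a b P Q U V].
Proof.
move=> m0 a0 b0 P0 Q0 PQm.
have [[U V] /= [U0 V0] minUV] := @polar_objective_min R m a b P Q a0 b0 P0 Q0.
exists (U, V); split=> //=.
have eU : V * (U * V - m) = a * (P - U).
  by apply: (@polar_objective_critical _ _ _ b _ Q) => // U' ?; exact: minUV.
have eV : U * (V * U - m) = b * (Q - V).
  apply: (@polar_objective_critical _ _ _ a _ P) => // V' ?.
  by rewrite !(polar_objectiveC m b); exact: minUV.
have [//|mUV] := leP (U * V) m.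
have PU : 0 <= P - U.
  by rewrite -(pmulr_rge0 _ a0) -eU mulr_ge0 // subr_ge0 ltW.
have QV : 0 <= Q - V.
  by rewrite -(pmulr_rge0 _ b0) -eV mulr_ge0 // subr_ge0 mulrC ltW.
(* The goal [false] is turned back into [U * V <= m], which follows from [U <= P], [V <= Q] and
   [P * Q <= m]. *)
by rewrite -(lt_geF mUV); apply: le_trans PQm; apply: ler_pM => //; rewrite -subr_ge0.
Qed.

Lemma norm_complex_real (R : realType) (u : R[i]) : exists2 U : R, 0 <= U & `|u| = U%:C.
Proof. by exists (ComplexField.Normc.normc u) => //; case: u => x y; exact: sqrtr_ge0. Qed.

Lemma norm_ge0_real (R : realType) (U : R) : 0 <= U -> `|U%:C| = U%:C.
Proof. by move=> U0; rewrite ger0_norm // lecR. Qed.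

Lemma complex_polar (R : realType) (z : R[i]) :
  exists w : R[i], exists2 m : R, 0 <= m & `|w| = 1 /\ z = w * m%:C.
Proof.
have [m m0 zm] := norm_complex_real z.
have [z0|z0] := eqVneq z 0.
  by exists 1, 0; rewrite // normr1 z0 mulr0.
exists (z / `|z|), m; rewrite // -zm normrM normfV normr_id divff ?normr_eq0 //.
by rewrite divfK ?normr_eq0.
Qed.

(** The phases cancel because [w^* * w] is [|w|^2 = 1]; this makes the products in (ii) and (iii)
    real. *)
Lemma conjc_polar_mul (R : realType) (w : R[i]) (m P : R) :
  `|w| = 1 -> (w * m%:C)^* * (w * P%:C) = (m * P)%:C.
Proof.
move=> w1; transitivity (`|w| ^+ 2 * (m * P)%:C); last by rewrite w1 expr1n mul1r.
rewrite -add_Re2_Im2; case: w {w1} => u v; apply/eqP; rewrite eq_complex /=.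
by apply/andP; split; apply/eqP; ring.
Qed.

(** The arguments are increments, so the new iterates are [w U] and [V]; the phase then factors out
    of every norm. *)
Lemma objective_polar (R : realType) (w : R[i]) (m a b P Q U V : R) :
  `|w| = 1 ->
  objective (w * m%:C) a b (w * P%:C) Q%:C (w * U%:C - w * P%:C, V%:C - Q%:C)
  = (polar_objective m a b P Q U V)%:C.
Proof.
move=> w1; rewrite /objective /polar_objective /= !subrK -mulrA -!mulrBr.
rewrite !normrM w1 !mul1r -!rmorphM -!rmorphB.
have sqrE (x : R) : `|x%:C| ^+ 2 = (x ^+ 2)%:C.
  by rewrite rmorphXn /= real_normK //; apply/complex_realP; exists x.
by rewrite !sqrE -!rmorphM -!rmorphD.
Qed.

Lemma sqr_dist_norm_le (C : numDomainType) (x y : C) :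
  (`|x| - `|y|) ^+ 2 <= `|x - y| ^+ 2.
Proof.
(* The order is only partial here; being real lets the difference be replaced by its absolute value
   under the square. *)
have r : `|x| - `|y| \is Num.real by rewrite rpredB ?normr_real.
by rewrite -(real_normK r) lerXn2r ?nnegrE //; exact: ler_dist_dist.
Qed.

Lemma objective_polar_le (R : realType) (w : R[i]) (m a b P Q U V : R)
    (p q : R[i]) :
  `|w| = 1 -> 0 <= m -> 0 <= a -> 0 <= b -> 0 <= P -> 0 <= Q ->
  `|p + w * P%:C| = U%:C -> `|q + Q%:C| = V%:C ->
  (polar_objective m a b P Q U V)%:C <=
  objective (w * m%:C) a b (w * P%:C) Q%:C (p, q).
Proof.
move=> w1 m0 a0 b0 P0 Q0 pU qV; rewrite /objective /polar_objective /=.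
rewrite !rmorphD 2!(rmorphM _ (_ : R) (_ ^+ 2)) !rmorphXn !rmorphB rmorphM /=.
have normw (x : R) : 0 <= x -> `|w * x%:C| = x%:C.
  by move=> x0; rewrite normrM w1 mul1r norm_ge0_real.
rewrite lerD ?lerD //.
- have := sqr_dist_norm_le ((p + w * P%:C) * (q + Q%:C)) (w * m%:C).
  by rewrite normrM pU qV normw.
- rewrite ler_wpM2l ?lecR //.
  by have := sqr_dist_norm_le (p + w * P%:C) (w * P%:C); rewrite pU normw // addrK.
- rewrite ler_wpM2l ?lecR //.
  by have := sqr_dist_norm_le (q + Q%:C) Q%:C; rewrite qV norm_ge0_real // addrK.
Qed.

Theorem theorem3p5 (R : realType) (r s : R) (hr : 0 <= r) (hs : 0 <= s)
    (lambda mu : nat -> R)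
    (lambda_gt0 : forall n, 0 < lambda n) (mu_gt0 : forall n, 0 < mu n)
    (lambda_dec : nonincreasing_seq lambda) (mu_dec : nonincreasing_seq mu)
    (z : R[i]) (x : 'rV[R]_2) :
  let a := fun n : nat => lambda n * Delta x `^ r in
  let b := fun n : nat => mu n * Delta x `^ s in
  exists p q pstar qstar : nat -> R[i],
    [/\ forall n : nat, argmin (objective z (a n) (b n) (prev_term p n) (prev_term q n))
                         (pstar n, qstar n),
        forall n : nat, p n = prev_term p n + pstar n,
        forall n : nat, q n = prev_term q n + qstar n
      & forall n : nat,
        [/\ 0 <= q n,
            z^* * p n = z * (p n)^* /\ 0 <= z^* * p n
          & z^* * p n * q n <= `|z| ^+ 2] ].
Proof.
move=> a b.
have D0 : 0 < Delta x by rewrite ltr_pwDl // sumr_ge0 // => i _; exact: sqr_ge0.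
have a0 n : 0 < a n by rewrite mulr_gt0 // powR_gt0.
have b0 n : 0 < b n by rewrite mulr_gt0 // powR_gt0.
have [w [m m0 [w1 zE]]] := complex_polar z.
pose good (t : R * R) := [/\ 0 <= t.1, 0 <= t.2 & t.1 * t.2 <= m].
pose opt n (t t' : R * R) := forall U V, 0 <= U -> 0 <= V ->
  polar_objective m (a n) (b n) t.1 t.2 t'.1 t'.2
  <= polar_objective m (a n) (b n) t.1 t.2 U V.
have /choice[next nextP] : forall nt : nat * (R * R), exists t' : R * R,
    good nt.2 -> good t' /\ opt nt.1 nt.2 t'.
  (* [next] has to be total: for a state that is not good the claim is vacuous and [(0, 0)] is a
     placeholder. *)
  case=> n [P Q]; have [[P0 Q0 PQm]|] := pselect (good (P, Q)); last by exists (0, 0).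
  by have [t' [t1 t2 tm t'P]] := polar_step m0 (a0 n) (b0 n) P0 Q0 PQm; exists t'.
(* [st n] holds the moduli of the iterates of index [n - 1], so [st 0] encodes the convention at
   index -1 and [p n], [q n] read [st n.+1]. *)
pose st := fix st n := if n is k.+1 then next (k, st k) else (0, 0).
have st_good n : good (st n).
  elim: n => [|n IH]; first by split; rewrite /= ?mul0r.
  by have [] := nextP (n, st n) IH.
have st_opt n : opt n (st n) (st n.+1) by have [] := nextP (n, st n) (st_good n).
pose p n := w * (st n.+1).1%:C; pose q n := (st n.+1).2%:C.
have prevp n : prev_term p n = w * (st n).1%:C by case: n => //=; rewrite mulr0.
have prevq n : prev_term q n = (st n).2%:C by case: n.
have zpE n : z^* * p n = (m * (st n.+1).1)%:C by rewrite zE; exact: conjc_polar_mul.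
exists p, q, (fun n => p n - prev_term p n), (fun n => q n - prev_term q n).
split=> n; try by rewrite addrC subrK.
- move=> [p' q']; rewrite prevp prevq zE objective_polar //.
  have [P0 Q0 _] := st_good n.
  (* A competitor is compared through the moduli of the iterates it would produce. *)
  have [U U0 pU] := norm_complex_real (p' + w * (st n).1%:C).
  have [V V0 qV] := norm_complex_real (q' + (st n).2%:C).
  apply: le_trans
    (objective_polar_le w1 m0 (ltW (a0 n)) (ltW (b0 n)) P0 Q0 pU qV).
  by rewrite lecR; exact: st_opt.
- have [P0 Q0 PQm] := st_good n.+1; rewrite zpE; split; first by rewrite lecR.
  + split; last by rewrite lecR mulr_ge0.
    (* The same cancellation of phases, with [m] and the modulus of [p n] exchanged. *)
    by rewrite zE mulrC [RHS]mulrC; apply: esym; exact: conjc_polar_mul.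
  (* As [|z| = m], claim (iii) is the invariant [P Q <= m] multiplied by [m]. *)
  + rewrite -rmorphM zE normrM w1 mul1r norm_ge0_real // -rmorphXn lecR expr2 -mulrA.
    exact: ler_wpM2l.
Qed.
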